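(* Let $n$ be a nonnegative integer and let $a,c$ be complex numbers such that no lower parameter of the series below is a nonpositive integer and all denominators below are nonzero. Then $$\frac{(c-a)_n}{(c-1)_n}={}_5F_4\left[\begin{matrix}-\frac n2,\ \frac{1-n}{2},\ \frac{1-a}{2},\ \frac{2-a}{2},\ c-a\\ \frac12,\ c-1,\ 2-c-n,\ c-a+n\end{matrix};-4\right]-\frac{n(1-a)(c-a+1)}{(1-c)(c-a+n)}\;{}_6F_5\left[\begin{matrix}1+\frac{1+c-a}{3},\ \frac{1-n}{2},\ \frac{2-n}{2},\ \frac{2-a}{2},\ \frac{3-a}{2},\ c-a\\ \frac32,\ \frac{1+c-a}{3},\ c,\ 2-c-n,\ c+1-a+n\end{matrix};-4\right].$$
   Context: $(x)_0=1$ and $(x)_n=x(x+1)\cdots(x+n-1)$ for $n\ge1$. The generalized hypergeometric series is ${}_pF_q\left[\begin{matrix}a_1,\dots,a_p\\ b_1,\dots,b_q\end{matrix};z\right]=\sum_{k\ge0}\frac{(a_1)_k\cdots(a_p)_k}{(b_1)_k\cdots(b_q)_k}\frac{z^k}{k!}$, with lower parameters $b_j\in\mathbb{C}\setminus\mathbb{Z}_{\le0}$. The series involved terminate; a term whose coefficient vanishes because of the factor $n$ (when $n=0$) is read as $0$. *)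

(* Defs.v *)
From mathcomp Require Import all_boot all_order all_algebra.
From mathcomp Require Export complex.
From mathcomp Require Import all_classical all_reals all_analysis.

Set Implicit Arguments.
Unset Strict Implicit.
Unset Printing Implicit Defensive.

Import Order.TTheory GRing.Theory Num.Theory.
Import numFieldNormedType.Exports.

Local Open Scope ring_scope.

Section Hypergeometric.
Variable K : numFieldType.
Implicit Types (x z : K) (upper lower : seq K).

Definition pochhammer x (k : nat) : K := \prod_(i < k) (x + i%:R).

Definition hyp_term upper lower z (k : nat) : K :=
  (\prod_(a <- upper) pochhammer a k) / (\prod_(b <- lower) pochhammer b k)
  * (z ^+ k / k`!%:R).

(* The sum is the limit of the partial sums in the topology of [K]. As [limn]
   is total, [hypergeometric] has an unspecified value in [K] when the series
   diverges; a product of this value with 0 is therefore 0. *)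
Definition hypergeometric upper lower z : K :=
  limn (series (hyp_term upper lower z)).

Definition nonpos_int x : Prop := exists m : nat, x = - m%:R.

End Hypergeometric.

(* Main.v *)
Require Import Defs.
From mathcomp Require Import all_boot all_order all_algebra.
From mathcomp Require Import ring.
From mathcomp Require Import all_classical all_reals all_analysis.

(** Put [s = c - a] and [t = 1 - a], so that [c - 1 = s - t].  The halved
    parameters form pairs [x/2, (x+1)/2], and
    [(x/2)_j ((x+1)/2)_j 4^j = (x)_{2j}]; with the reflection
    [(1-x-n)_j = (-1)^j (x+n-j)_j], the [j]-th terms of the two series,
    multiplied by [(s-t)_n] (and the second one by its prefactor and by [-1]),
    become the terms of index [2j] and [2j+1] of a single finite sum

      [S(t) = sum_{k <= n} C(n,k) (t)_k (s-t+ceil(k/2))_{n-k} w_k],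

    where [w_{2j} = (s)_j / (s+n)_j] and
    [w_{2j+1} = (s)_j (s+1+3j) / (s+n)_{j+1}].  The factor [s+1+3j] is what the
    parameters [1+(1+s)/3] over [(1+s)/3] contribute.  The theorem then says
    that [S(t) = (s)_n] ([sum_summand]).

    The weights [w_k] do not involve [t], so [S] is a polynomial in [t].  Each
    difference between [t+1] and [t] of a summand is a telescoping difference
    [G_{k+1} - G_k] in [k], with an explicit [G] that vanishes at [k = 0] and
    [k = n+1] ([summand_shift_sub]).  Hence [S(t+1) = S(t)], so the polynomial
    [S] is constant, and at [t = 0] only the term [k = 0], equal to [(s)_n],
    survives. *)

Import Order.TTheory GRing.Theory Num.Theory.
Import numFieldNormedType.Exports.

Local Open Scope ring_scope.

Set Implicit Arguments.
Unset Strict Implicit.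
Unset Printing Implicit Defensive.

(** * Pochhammer symbols *)

Lemma pochhammer0 (K : numFieldType) (x : K) : pochhammer x 0 = 1.
Proof. by rewrite /pochhammer big_ord0. Qed.

Lemma pochhammerSr (K : numFieldType) (x : K) k :
  pochhammer x k.+1 = pochhammer x k * (x + k%:R).
Proof. by rewrite /pochhammer big_ord_recr. Qed.

Lemma pochhammerD (K : numFieldType) (x : K) m k :
  pochhammer x (m + k) = pochhammer x m * pochhammer (x + m%:R) k.
Proof.
elim: k => [|k IHk]; first by rewrite addn0 pochhammer0 mulr1.
by rewrite addnS !pochhammerSr IHk natrD -mulrA addrA.
Qed.

Lemma pochhammerSl (K : numFieldType) (x : K) k :
  pochhammer x k.+1 = x * pochhammer (x + 1) k.
Proof.
by rewrite -add1n pochhammerD pochhammerSr pochhammer0 mul1r addr0.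
Qed.

(** The discrete analogue of [(x^k)' = k x^(k-1)]: the two products share
    the factors [x + 1, ..., x + k - 1]. *)
Lemma pochhammer_shift_sub (K : numFieldType) (x : K) k :
  pochhammer (x + 1) k - pochhammer x k = k%:R * pochhammer (x + 1) k.-1.
Proof.
case: k => [|k]; first by rewrite !pochhammer0; ring.
by rewrite [pochhammer x _]pochhammerSl pochhammerSr -natr1 /=; ring.
Qed.

Lemma pochhammer_neq0 (K : numFieldType) (x : K) k :
  ~ nonpos_int x -> pochhammer x k != 0.
Proof.
move=> x_ok; apply/prodf_neq0 => i _; apply/eqP => xi0.
by apply: x_ok; exists i; apply/eqP; rewrite -addr_eq0 xi0.
Qed.

Lemma pochhammer_1 (K : numFieldType) k : pochhammer (1 : K) k = k`!%:R.
Proof.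
elim: k => [|k IHk]; first by rewrite pochhammer0.
by rewrite pochhammerSr IHk factS mulnC natrM nat1r.
Qed.

Lemma pochhammer_opp_nat (K : numFieldType) n k :
  pochhammer (- n%:R : K) k = (-1) ^+ k * (n ^_ k)%:R.
Proof.
elim: k => [|k IHk]; first by rewrite pochhammer0 expr0 mul1r.
rewrite pochhammerSr IHk ffactnSr natrM exprS.
have [le_kn|lt_nk] := leqP k n; first by rewrite natrB //; ring.
by rewrite ffact_small // !(mulr0, mul0r).
Qed.

Lemma pochhammer_opp_nat_double (K : numFieldType) n k :
  pochhammer (- n%:R : K) k.*2 = 'C(n, k.*2)%:R * (k.*2)`!%:R.
Proof.
by rewrite pochhammer_opp_nat -natrM bin_ffact -mul2n exprM sqrrN !expr1n mul1r.
Qed.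

Lemma pochhammer_opp_nat_doubleS (K : numFieldType) n k :
  n%:R * pochhammer (- n%:R + 1 : K) k.*2
  = 'C(n, k.*2.+1)%:R * (k.*2.+1)`!%:R.
Proof.
apply: oppr_inj; rewrite -mulNr -pochhammerSl pochhammer_opp_nat -natrM.
by rewrite bin_ffact exprS -mul2n exprM sqrrN !expr1n mulr1 mulN1r.
Qed.

(** Duplication: interleaving the factors [x/2 + i] and [(x+1)/2 + i], each
    multiplied by 2, gives [x, x + 1, x + 2, ...]. *)
Lemma pochhammer_double (K : numFieldType) (x : K) k :
  pochhammer (x / 2) k * pochhammer ((x + 1) / 2) k * 4 ^+ k
  = pochhammer x k.*2.
Proof.
elim: k => [|k IHk]; first by rewrite !pochhammer0; ring.
by rewrite doubleS !pochhammerSr -IHk exprS -addn1 -muln2 natrD natrM; field.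
Qed.

(** Reversing the order of the factors and changing all the signs. *)
Lemma pochhammer_reflect (K : numFieldType) (x : K) k :
  pochhammer (1 - x - k%:R) k = (-1) ^+ k * pochhammer x k.
Proof.
elim: k => [|k IHk]; first by rewrite !pochhammer0 expr0 mulr1.
rewrite pochhammerSl pochhammerSr exprS -natr1.
have -> : 1 - x - (k%:R + 1) + 1 = 1 - x - k%:R by ring.
by rewrite IHk; ring.
Qed.

(** The factor [k!] of a hypergeometric term is [(1)_k]; paired with [(1/2)_k]
    or [(3/2)_k] it is subject to duplication. *)
Lemma fact_double (K : numFieldType) k :
  pochhammer (1 / 2 : K) k * k`!%:R * 4 ^+ k = (k.*2)`!%:R.
Proof.
rewrite -!pochhammer_1 -pochhammer_double.
by have -> : (1 + 1) / 2 = 1 :> K by field.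
Qed.

Lemma fact_doubleS (K : numFieldType) k :
  pochhammer (3 / 2 : K) k * k`!%:R * 4 ^+ k = (k.*2.+1)`!%:R.
Proof.
rewrite -!pochhammer_1 pochhammerSl mul1r -pochhammer_double.
have -> : (1 + 1) / 2 = 1 :> K by field.
have -> : (1 + 1 + 1) / 2 = 3 / 2 :> K by field.
by rewrite [pochhammer 1 k * _]mulrC.
Qed.

Lemma pochhammer_pair_eq0 (K : numFieldType) n k :
  (n < k.*2)%N ->
  pochhammer (- n%:R / 2 : K) k * pochhammer ((- n%:R + 1) / 2) k = 0.
Proof.
move=> lt_nk; apply: (@mulIf _ (4 ^+ k)); first by rewrite expf_neq0 ?pnatr_eq0.
by rewrite pochhammer_double pochhammer_opp_nat ffact_small // mulr0 mul0r.
Qed.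

(** The last block is, up to sign, the reflected symbol [(1 - x - n)_j], see
    [pochhammer_reflect_sub]: this is why [(2 - c - n)_j] cancels in a term
    multiplied by [(c - 1)_n]. *)
Lemma pochhammer_split (K : numFieldType) (x : K) n i j :
  (i + j <= n)%N ->
  pochhammer x n = pochhammer x i * pochhammer (x + i%:R) (n - (i + j))
                   * pochhammer (x + (n - j)%:R) j.
Proof.
move=> le_ijn; have njE : (n - j = i + (n - (i + j)))%N.
  rewrite addnC [(i + j)%N]addnC subnDA subnK // leq_subRL ?(addnC j) //.
  by rewrite (leq_trans _ le_ijn) ?leq_addl.
rewrite -pochhammerD -njE -pochhammerD subnK //.
by rewrite (leq_trans _ le_ijn) ?leq_addl.
Qed.

Lemma pochhammer_reflect_sub (K : numFieldType) (x : K) n j :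
  (j <= n)%N ->
  pochhammer (1 - x - n%:R) j = (-1) ^+ j * pochhammer (x + (n - j)%:R) j.
Proof.
move=> le_jn; rewrite -pochhammer_reflect; congr pochhammer.
by rewrite natrB //; ring.
Qed.

(** * Polynomial functions *)

Definition polynomial_function (K : numFieldType) (f : K -> K) : Prop :=
  exists p : {poly K}, forall x, f x = p.[x].

Lemma polynomial_cst (K : numFieldType) (a : K) :
  polynomial_function (fun=> a).
Proof. by exists a%:P => x; rewrite hornerC. Qed.

Lemma polynomial_id (K : numFieldType) : polynomial_function (@id K).
Proof. by exists 'X => x; rewrite hornerX. Qed.

Lemma polynomial_opp (K : numFieldType) (f : K -> K) :
  polynomial_function f -> polynomial_function (fun x => - f x).
Proof. by move=> [p fE]; exists (- p) => x; rewrite hornerN fE. Qed.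

Lemma polynomial_add (K : numFieldType) (f g : K -> K) :
  polynomial_function f -> polynomial_function g ->
  polynomial_function (fun x => f x + g x).
Proof. by move=> [p fE] [q gE]; exists (p + q) => x; rewrite hornerD fE gE. Qed.

Lemma polynomial_mul (K : numFieldType) (f g : K -> K) :
  polynomial_function f -> polynomial_function g ->
  polynomial_function (fun x => f x * g x).
Proof. by move=> [p fE] [q gE]; exists (p * q) => x; rewrite hornerM fE gE. Qed.

Lemma polynomial_sum (K : numFieldType) m (f : nat -> K -> K) :
  (forall k, polynomial_function (f k)) ->
  polynomial_function (fun x => \sum_(k < m) f k x).
Proof.
move=> /choice[p fE]; exists (\sum_(k < m) p k) => x.
by rewrite horner_sum; apply: eq_bigr => k _; rewrite fE.
Qed.

Lemma polynomial_pochhammer (K : numFieldType) (f : K -> K) k :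
  polynomial_function f -> polynomial_function (fun x => pochhammer (f x) k).
Proof.
move=> [p fE]; exists (\prod_(i < k) (p + i%:R%:P)) => x.
by rewrite horner_prod; apply: eq_bigr => i _; rewrite hornerD hornerC fE.
Qed.

(** A polynomial function of period 1 takes the value [f 0] at every natural
    number, hence too often not to be constant in characteristic 0. *)
Lemma polynomial_periodic_cst (K : numFieldType) (f : K -> K) :
  polynomial_function f -> (forall x, f (x + 1) = f x) ->
  forall x, f x = f 0.
Proof.
move=> [p fE] f_per x.
have f_nat m : f m%:R = f 0.
  by elim: m => // m IHm; rewrite -natr1 f_per.
have : p - (f 0)%:P = 0.
  pose rs : seq K := [seq m%:R | m <- iota 0 (size (p - (f 0)%:P))].
  apply: (@roots_geq_poly_eq0 _ _ rs); last by rewrite size_map size_iota.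
    apply/allP => _ /mapP[m _ ->].
    by rewrite rootE hornerD hornerN hornerC -fE f_nat subrr.
  rewrite map_inj_uniq ?iota_uniq // => i j /eqP.
  by rewrite eqr_nat => /eqP.
by move/eqP; rewrite subr_eq0 => /eqP pE; rewrite fE pE hornerC.
Qed.

(** * The terminating sum *)

(** The parity test and the two roundings of [k / 2] merge both series of the
    theorem: index [2j] is the [j]-th term of the first one and [2j + 1] that
    of the second one. *)
Definition summand (K : numFieldType) n (s t : K) k : K :=
  'C(n, k)%:R * pochhammer t k * pochhammer (s - t + (uphalf k)%:R) (n - k)
  * (pochhammer s k./2 * (if odd k then s + 1 + 3 * (k./2)%:R else 1)
     / pochhammer (s + n%:R) (uphalf k)).

(** Found by summing the first few differences of [summand] between [t + 1] and
    [t]: the partial sums factor completely. *)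
Definition certificate (K : numFieldType) n (s t : K) k : K :=
  - (k%:R * 'C(n, k)%:R) * pochhammer (t + 1) k.-1
  * pochhammer (s - t + (k./2)%:R) (n - k)
  * (pochhammer s k./2 / pochhammer (s + n%:R) k./2).

(** Up to the common factor ['C(n, k)], with [m = n - k], this compares
    [(t+1)_k (x-1)_m - (t)_k (x)_m], where [x = s - t + uphalf k], with
    two products of the same kind.  For even [k] it is the product rule for
    differences; for odd [k] the choice of the factor [s + 1 + 3j] makes the
    polynomials left after removing common factors agree. *)
Lemma summand_shift_sub (K : numFieldType) n (s t : K) k :
  (forall j, pochhammer (s + n%:R) j != 0) -> (k <= n)%N ->
  summand n s (t + 1) k - summand n s t k
  = certificate n s t k.+1 - certificate n s t k.
Proof.
move=> sn_neq0 le_kn.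
have binS : k.+1%:R * 'C(n, k.+1)%:R = (n - k)%:R * 'C(n, k)%:R :> K.
  by rewrite -!natrM mul_bin_left.
rewrite /summand /certificate binS subnS /=.
have nE : n%:R = (n - k)%:R + k%:R :> K by rewrite -natrD subnK.
have -> : s - (t + 1) + (uphalf k)%:R = s - t + (uphalf k)%:R - 1 by ring.
move: (n - k)%N nE => m nE.
have kE := odd_double_half k.
rewrite uphalf_half; case: (odd k) kE => kE; last first.
  rewrite add0n.
  have := pochhammer_shift_sub (s - t + (k./2)%:R - 1) m.
  rewrite subrK; set y := s - t + _ => /eqP; rewrite subr_eq => /eqP ->.
  have := pochhammer_shift_sub t k.
  move=> /eqP; rewrite subr_eq => /eqP ->.
  field; exact: sn_neq0.
(* Odd index: with k = 2j + 1, the products on t and on s - t are unfolded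
   down to their common factors, leaving a polynomial identity. *)
rewrite add1n; move: (k./2) kE nE => j <- nE; rewrite add1n /= in nE *.
have -> : s - t + j.+1%:R - 1 = s - t + j%:R by rewrite -natr1; ring.
have := sn_neq0 j.+1.
rewrite [pochhammer t _]pochhammerSl !pochhammerSr mulf_eq0 negb_or.
move=> /andP[V0 u0].
have kE : (j.*2.+1)%:R = 2 * j%:R + 1 :> K by rewrite -natr1 -muln2 natrM mulrC.
rewrite kE.
move: (pochhammer (s + n%:R) j) V0 => V V0.
have kE' : (j.*2)%:R = 2 * j%:R :> K by rewrite -muln2 natrM mulrC.
rewrite kE in nE; rewrite kE' -[j.+1%:R]natr1 nE [_ + (j%:R + 1)]addrA in u0 *.
case: m {nE} u0 => [|m] u0.
  by rewrite !pochhammer0 !add0r in u0 *; field; rewrite V0 u0.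
rewrite [pochhammer (s - t + j%:R) _]pochhammerSl pochhammerSr.
by rewrite -[m.+1%:R]natr1 /= in u0 *; field; rewrite V0 u0.
Qed.

Lemma summand_at0 (K : numFieldType) n (s : K) k :
  summand n s 0 k.+1 = 0.
Proof. by rewrite /summand pochhammerSl !(mul0r, mulr0). Qed.

Lemma sum_summand (K : numFieldType) n (s t : K) :
  (forall j, pochhammer (s + n%:R) j != 0) ->
  \sum_(k < n.+1) summand n s t k = pochhammer s n.
Proof.
move=> sn_neq0.
have poly_sum : polynomial_function (fun t => \sum_(k < n.+1) summand n s t k).
  apply: (@polynomial_sum K _ (fun k t => summand n s t k)) => k.
  apply: polynomial_mul; last exact: polynomial_cst.
  apply: polynomial_mul.
    apply: polynomial_mul; first exact: polynomial_cst.
    exact/polynomial_pochhammer/polynomial_id.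
  apply/polynomial_pochhammer/polynomial_add; last exact: polynomial_cst.
  apply: polynomial_add; first exact: polynomial_cst.
  exact/polynomial_opp/polynomial_id.
rewrite (polynomial_periodic_cst poly_sum) => [|{}t].
  rewrite big_ord_recl big1 => [|k _]; last exact: summand_at0.
  rewrite /summand /= !pochhammer0 bin0 subn0 subr0 !addr0.
  by rewrite !mul1r divr1.
apply: subr0_eq; rewrite -sumrB.
under eq_bigr => k _ do rewrite (summand_shift_sub _ sn_neq0 (leq_ord k)).
rewrite -(big_mkord xpredT
  (fun k => certificate n s t k.+1 - certificate n s t k)).
rewrite telescope_sumr // /certificate bin_small //.
by rewrite !(mulr0, mul0r, oppr0, subr0).
Qed.

Lemma sum_even_odd (K : numFieldType) N (F : nat -> K) :
  \sum_(k < N.*2) F k = \sum_(j < N) (F j.*2 + F j.*2.+1).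
Proof.
elim: N => [|N IHN]; first by rewrite !big_ord0.
by rewrite doubleS !big_ord_recr /= IHN addrA.
Qed.

(** The bound [n] on the half-index is larger than needed, so that it serves
    both parities: the extra summands contain a vanishing binomial. *)
Lemma sum_summand_even_odd (K : numFieldType) n (s t : K) :
  (forall j, pochhammer (s + n%:R) j != 0) ->
  \sum_(j < n.+1) (summand n s t j.*2 + summand n s t j.*2.+1)
  = pochhammer s n.
Proof.
move=> sn_neq0; rewrite -sum_even_odd -(sum_summand t sn_neq0).
rewrite -addnn big_split_ord /= [X in _ + X]big1 ?addr0 // => k _.
by rewrite /summand bin_small ?mul0r // leq_addr.
Qed.

(** * Terms of the two hypergeometric series *)

(** Only the product of two upper Pochhammer symbols is required to vanish:
    which member of the pair [- n / 2, (1 - n) / 2] ends the series depends on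
    the parity of [n]. *)
Lemma hyp_term_eq0 (K : numFieldType) (upper lower : seq K) z (x y : K) k :
  x \in upper -> y \in upper -> pochhammer x k * pochhammer y k = 0 ->
  hyp_term upper lower z k = 0.
Proof.
have upper_eq0 u : u \in upper -> pochhammer u k = 0 ->
    hyp_term upper lower z k = 0.
  by move=> u_in u0; rewrite /hyp_term (big_rem u) //= u0 !mul0r.
move=> x_in y_in /eqP; rewrite mulf_eq0 => /orP[] /eqP; exact: upper_eq0.
Qed.

(** The partial sums are eventually constant, and limits are unique. *)
Lemma hypergeometric_terminating (K : numFieldType) (upper lower : seq K) z N :
  (forall k, (N <= k)%N -> hyp_term upper lower z k = 0) ->
  hypergeometric upper lower z = \sum_(k < N) hyp_term upper lower z k.
Proof.
move=> term0; apply: (@cvg_lim K^o); first exact: norm_hausdorff.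
apply: cvg_near_cst; exists N => // m /= le_Nm.
rewrite /series /= (big_cat_nat (leq0n N) le_Nm) /= big_mkord.
rewrite [X in _ + X]big_nat_cond [X in _ + X]big1 ?addr0 // => k.
by move=> /andP[/andP[/term0]].
Qed.

(** Duplication divides each of [(-n)_{2j}] and [(t)_{2j}] above, and [(2j)!]
    below, by [4^j]; together with the argument [-4] these powers of 4 cancel,
    and reflection of [1 - (s - t) - n] absorbs the sign. *)
Lemma hyp_term_even (K : numFieldType) n (s t : K) j :
  (forall i, pochhammer (s - t) i != 0) ->
  (forall i, pochhammer (s + n%:R) i != 0) ->
  hyp_term
    [:: - n%:R / 2; (- n%:R + 1) / 2; t / 2; (t + 1) / 2; s]
    [:: 1 / 2; s - t; 1 - (s - t) - n%:R; s + n%:R] (- 4) j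
  * pochhammer (s - t) n = summand n s t j.*2.
Proof.
move=> x_neq0 sn_neq0; have [lt_nj|le_jn] := ltnP n j.*2.
  rewrite (hyp_term_eq0 _ _ _ _ (pochhammer_pair_eq0 _ lt_nj));
    rewrite ?inE ?eqxx ?orbT //.
  by rewrite /summand bin_small // !mul0r.
have le_jjn : (j + j <= n)%N by rewrite addnn.
have xnE := pochhammer_split (s - t) le_jjn; rewrite addnn in xnE.
have le_j_n : (j <= n)%N by rewrite (leq_trans (leq_addr _ _) le_jjn).
have := x_neq0 n; rewrite xnE !mulf_eq0 !negb_or => /andP[/andP[xj0 _] y0].
rewrite /hyp_term !big_cons !big_nil pochhammer_reflect_sub // /summand.
rewrite odd_double doubleK uphalf_double.
rewrite -(pochhammer_double t).
have := pochhammer_opp_nat_double K n j.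
rewrite -pochhammer_double -fact_double.
have : (j.*2)`!%:R != 0 :> K by rewrite pnatr_eq0 -lt0n fact_gt0.
rewrite -fact_double !mulf_eq0 !negb_or => /andP[/andP[B0 f0] p0].
rewrite mulrA => /(mulIf p0)/esym/(canRL (mulfK (mulf_neq0 B0 f0))) ->.
rewrite -[- 4]mulN1r exprMn.
have e0 : (-1) ^+ j != 0 :> K by rewrite signr_eq0.
move: (_ ^+ j) (_ ^+ j) e0 p0 => p e e0 p0.
by field; rewrite sn_neq0 f0 B0 y0 e0.
Qed.

(** For [n = 0] the second series need not terminate, as [(1 - n)/2] and
    [(2 - n)/2] are then both positive. *)
Lemma hyp_term_odd_eq0 (K : numFieldType) n (s t : K) j :
  (0 < n)%N -> (n <= j.*2)%N ->
  hyp_term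
    [:: 1 + (1 + s) / 3; (- n%:R + 1) / 2; (- n%:R + 1 + 1) / 2;
        (t + 1) / 2; (t + 1 + 1) / 2; s]
    [:: 3 / 2; (1 + s) / 3; s - t + 1; 1 - (s - t) - n%:R; s + n%:R + 1]
    (- 4) j = 0.
Proof.
case: n => // n _ lt_nj.
have nE : - n.+1%:R + 1 = - n%:R :> K by rewrite -natr1; ring.
rewrite nE (hyp_term_eq0 _ _ _ _ (pochhammer_pair_eq0 _ lt_nj)) //;
  by rewrite !inE eqxx ?orbT.
Qed.

(** As in the even case; the prefactor supplies the first factors of
    [(-n)_{2j+1}], [(t)_{2j+1}], [(s-t)_{j+1}] and [(s+n)_{j+1}], and
    [(1+r)_j / (r)_j = (r+j) / r] with [r = (1+s)/3] gives
    [(s+1+3j) / (s+1)]. *)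
Lemma hyp_term_odd (K : numFieldType) n (s t : K) j :
  (forall i, pochhammer (s - t) i != 0) ->
  (forall i, pochhammer (s + n%:R) i != 0) ->
  (forall i, pochhammer ((1 + s) / 3) i != 0) ->
  n%:R * t * (s + 1) / (- (s - t) * (s + n%:R)) *
  hyp_term
    [:: 1 + (1 + s) / 3; (- n%:R + 1) / 2; (- n%:R + 1 + 1) / 2;
        (t + 1) / 2; (t + 1 + 1) / 2; s]
    [:: 3 / 2; (1 + s) / 3; s - t + 1; 1 - (s - t) - n%:R; s + n%:R + 1]
    (- 4) j
  * pochhammer (s - t) n = - summand n s t j.*2.+1.
Proof.
move=> x_neq0 sn_neq0 r_neq0; have [le_nj|lt_jn] := leqP n j.*2.
  rewrite /summand bin_small // !mul0r oppr0.
  have [->|n_gt0] := posnP n; first by rewrite !mul0r.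
  by rewrite hyp_term_odd_eq0 // mulr0 mul0r.
have le_Sjjn : (j.+1 + j <= n)%N by rewrite addSn addnn.
have xnE := pochhammer_split (s - t) le_Sjjn; rewrite addSn addnn in xnE.
have le_j_n : (j <= n)%N by rewrite (leq_trans (leq_addl _ _) le_Sjjn).
have := x_neq0 n; rewrite xnE !mulf_eq0 !negb_or => /andP[/andP[xj0 _] y0].
have := sn_neq0 j.+1; have r0 := r_neq0 1; have rj0 := r_neq0 j.
have rE : pochhammer (1 + (1 + s) / 3) j
    = pochhammer ((1 + s) / 3) j * ((1 + s) / 3 + j%:R) / ((1 + s) / 3).
  rewrite -pochhammerSr pochhammerSl [_ + 1]addrC mulrAC mulfV ?mul1r //.
  by rewrite pochhammerSr pochhammer0 mul1r addr0 in r0.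
rewrite pochhammerSr pochhammer0 mul1r addr0 in r0.
have s0 : 1 + s != 0 by apply: contraNneq r0 => ->; rewrite mul0r.
rewrite /hyp_term !big_cons !big_nil pochhammer_reflect_sub // /summand rE.
rewrite /= odd_double /= doubleK uphalf_double.
rewrite pochhammerSl mulf_eq0 negb_or => /andP[sn0 V0].
rewrite [pochhammer t _]pochhammerSl.
rewrite -(pochhammer_double (t + 1)).
have := pochhammer_opp_nat_doubleS K n j.
rewrite -pochhammer_double -fact_doubleS.
have : (j.*2.+1)`!%:R != 0 :> K by rewrite pnatr_eq0 -lt0n fact_gt0.
rewrite -fact_doubleS !mulf_eq0 !negb_or => /andP[/andP[B0 f0] p0].
rewrite !mulrA => /(mulIf p0) /esym.
rewrite -mulrA => /(canRL (mulfK (mulf_neq0 B0 f0))) ->.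
rewrite -[- 4]mulN1r exprMn.
have e0 : (-1) ^+ j != 0 :> K by rewrite signr_eq0.
rewrite pochhammerSl mulf_eq0 negb_or in xj0.
have {xj0}/andP[x0 xj0] := xj0.
rewrite [pochhammer (s - t) _]pochhammerSl.
move: (_ ^+ j) (_ ^+ j) e0 p0 => p e e0 p0.
by field; rewrite V0 sn0 f0 B0 y0 e0 xj0 rj0 s0.
Qed.

(** * Evaluation of the two series *)

Lemma hypergeometric_even (K : numFieldType) n (s t : K) :
  (forall i, pochhammer (s - t) i != 0) ->
  (forall i, pochhammer (s + n%:R) i != 0) ->
  hypergeometric
    [:: - n%:R / 2; (- n%:R + 1) / 2; t / 2; (t + 1) / 2; s]
    [:: 1 / 2; s - t; 1 - (s - t) - n%:R; s + n%:R] (- 4)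
  * pochhammer (s - t) n = \sum_(j < n.+1) summand n s t j.*2.
Proof.
move=> x_neq0 sn_neq0; rewrite (@hypergeometric_terminating _ _ _ _ n.+1).
  by rewrite mulr_suml; apply: eq_bigr => j _; exact: hyp_term_even.
move=> j lt_nj; have lt_nj2 : (n < j.*2)%N.
  by rewrite (leq_trans lt_nj) // -addnn leq_addr.
rewrite (hyp_term_eq0 _ _ _ _ (pochhammer_pair_eq0 _ lt_nj2)) //;
  by rewrite !inE eqxx ?orbT.
Qed.

(** For [n = 0] the prefactor vanishes, whatever the value of the series. *)
Lemma hypergeometric_odd (K : numFieldType) n (s t : K) :
  (forall i, pochhammer (s - t) i != 0) ->
  (forall i, pochhammer (s + n%:R) i != 0) ->
  (forall i, pochhammer ((1 + s) / 3) i != 0) ->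
  n%:R * t * (s + 1) / (- (s - t) * (s + n%:R)) *
  hypergeometric
    [:: 1 + (1 + s) / 3; (- n%:R + 1) / 2; (- n%:R + 1 + 1) / 2;
        (t + 1) / 2; (t + 1 + 1) / 2; s]
    [:: 3 / 2; (1 + s) / 3; s - t + 1; 1 - (s - t) - n%:R; s + n%:R + 1]
    (- 4)
  * pochhammer (s - t) n = - \sum_(j < n.+1) summand n s t j.*2.+1.
Proof.
move=> x_neq0 sn_neq0 r_neq0; have [n0|n_gt0] := posnP n.
  rewrite big1 => [|j _]; last first.
    by rewrite /summand bin_small ?mul0r // ltnS (leq_trans _ (leq0n _)) ?n0.
  by rewrite n0 !mul0r oppr0.
rewrite (@hypergeometric_terminating _ _ _ _ n.+1) => [|j lt_nj].
  rewrite mulr_sumr mulr_suml -sumrN.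
  by apply: eq_bigr => j _; exact: hyp_term_odd.
by rewrite hyp_term_odd_eq0 // (leq_trans (ltnW lt_nj)) // -addnn leq_addr.
Qed.

Unset Implicit Arguments.

Theorem theorem3p5 (R : realType) (n : nat) (a c : R[i])
  (lower5F4 : forall b : R[i],
     b \in [:: 1 / 2; c - 1; 2 - c - n%:R; c - a + n%:R] -> ~ nonpos_int b)
  (lower6F5 : forall b : R[i],
     b \in [:: 3 / 2; (1 + c - a) / 3; c; 2 - c - n%:R; c + 1 - a + n%:R] ->
     ~ nonpos_int b)
  (den_lhs : pochhammer (c - 1) n != 0)
  (den_coef : (1 - c) * (c - a + n%:R) != 0) :
  pochhammer (c - a) n / pochhammer (c - 1) n =
    hypergeometric
      [:: - (n%:R / 2); (1 - n%:R) / 2; (1 - a) / 2; (2 - a) / 2; c - a]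
      [:: 1 / 2; c - 1; 2 - c - n%:R; c - a + n%:R]
      (- 4)
    - n%:R * (1 - a) * (c - a + 1) / ((1 - c) * (c - a + n%:R))
      * hypergeometric
          [:: 1 + (1 + c - a) / 3; (1 - n%:R) / 2; (2 - n%:R) / 2;
              (2 - a) / 2; (3 - a) / 2; c - a]
          [:: 3 / 2; (1 + c - a) / 3; c; 2 - c - n%:R; c + 1 - a + n%:R]
          (- 4).
Proof.
have x_neq0 i : pochhammer (c - 1) i != 0.
  by apply/pochhammer_neq0/lower5F4; rewrite !inE eqxx orbT.
have sn_neq0 i : pochhammer (c - a + n%:R) i != 0.
  by apply/pochhammer_neq0/lower5F4; rewrite !inE eqxx !orbT.
have r_neq0 i : pochhammer ((1 + (c - a)) / 3) i != 0.
  by rewrite addrA; apply/pochhammer_neq0/lower6F5; rewrite !inE eqxx orbT.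
have xE : c - 1 = c - a - (1 - a) by ring.
rewrite xE in x_neq0.
have := hypergeometric_even x_neq0 sn_neq0.
have := hypergeometric_odd x_neq0 sn_neq0 r_neq0.
have := sum_summand_even_odd (1 - a) sn_neq0.
rewrite big_split /= -xE.
have -> : 1 - (c - 1) - n%:R = 2 - c - n%:R by ring.
have -> : 1 + (c - a) = 1 + c - a by ring.
have -> : c - 1 + 1 = c by ring.
have -> : c - a + n%:R + 1 = c + 1 - a + n%:R by ring.
have -> : - n%:R + 1 = 1 - n%:R :> R[i] by ring.
have -> : 1 - n%:R + 1 = 2 - n%:R :> R[i] by ring.
have -> : 1 - a + 1 = 2 - a by ring.
have -> : 2 - a + 1 = 3 - a by ring.
rewrite mulNr opprB => <- odd_sum even_sum.
by apply: (mulIf den_lhs); rewrite divfK // mulrBl odd_sum even_sum opprK.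
Qed.
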